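(* Let $(G,p)$ define a grillage in the plane, and suppose that $(G,p)$, regarded as a bar-and-joint framework in $\mathbb{R}^2$ with vertex $i$ at $p_i$, is infinitesimally rigid. Let $\omega\in\mathbb{R}^E$ be an equilibrium stress of the framework $(G,p)$ with $\omega_{ij}\neq0$ for every edge $ij\in E$. Define an over/under pattern by $$\varepsilon_{ij}=\operatorname{sign}(\omega_{ij})\operatorname{sign}(s_{ij})\qquad(ij\in E,\ i<j).$$ Then the weaving $(G,p,\varepsilon)$ is flat.
   Context: Let $\rho:\mathbb{R}^2\to\mathbb{R}^2$ be the counter-clockwise rotation through $\pi/2$. Grillages and weavings. A grillage $(G,p)$ consists of a finite simple graph $G=(V,E)$ with $V=\{1,\dots,n\}$ and a set of $n$ distinct lines $L_1,\dots,L_n$ in $\mathbb{R}^2$, none through the origin, where $L_i=\{x:\langle x,p_i\rangle=1\}$ for a nonzero $p_i\in\mathbb{R}^2$, such that $L_i$ and $L_j$ are not parallel whenever $ij\in E$. For $ij\in E$ put $s_{ij}=1/\det[p_i\ p_j]$; the crossing point of $L_i$ and $L_j$ is $q_{ij}=s_{ij}\rho(p_i-p_j)$. A weaving $(G,p,\varepsilon)$ is a grillage together with a sign $\varepsilon_{ij}\in\{\pm1\}$ for each edge $ij$ with $i<j$ ($+1$ means $L_i$ passes over $L_j$, $-1$ means $L_i$ passes under $L_j$). Flatness. A lifting of the weaving is a vector $v=(v_1,\dots,v_n)\in(\mathbb{R}^2)^n$ with $\varepsilon_{ij}\langle q_{ij},v_i-v_j\rangle\ge0$ for all $ij\in E$,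 $i<j$. A trivial lifting is one of the form $v_i=w+c\,p_i$ for all $i$, with $w\in\mathbb{R}^2$, $c\in\mathbb{R}$. The weaving is flat if every lifting is trivial. Frameworks. The bar-and-joint framework $(G,p)$ is infinitesimally rigid if every $p'\in(\mathbb{R}^2)^n$ with $\langle p_i-p_j,p'_i-p'_j\rangle=0$ for all $ij\in E$ is trivial, i.e. of the form $p'_i=w+c\,\rho(p_i)$ for all $i$, with $w\in\mathbb{R}^2$, $c\in\mathbb{R}$. An equilibrium stress of the framework is a vector $\omega\in\mathbb{R}^E$ (with $\omega_{ij}=\omega_{ji}$) such that $\sum_{j:\,ij\in E}\omega_{ij}(p_i-p_j)=0$ for every $i\in V$. *)

(* Defs.v *)
From mathcomp Require Import all_boot all_order all_algebra.
From mathcomp Require Import classical_sets reals.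

Set Implicit Arguments.
Unset Strict Implicit.
Unset Printing Implicit Defensive.

Import Order.TTheory GRing.Theory Num.Theory.
Local Open Scope ring_scope.

(* The vertex set {1, ..., n} is represented by 'I_n, with the same order. *)
Record simple_graph (n : nat) := SimpleGraph {
  edge :> rel 'I_n;
  edge_sym : symmetric edge;
  edge_irrefl : irreflexive edge }.

Section Plane.
Variable R : realType.
Implicit Types x y : 'cV[R]_2.

Definition dot x y : R := \sum_k x k 0 * y k 0.

(* Counter-clockwise rotation through a right angle. *)
Definition rho x : 'cV[R]_2 :=
  \col_k (if k == 0 then - x 1 0 else x 0 0).

Definition det2 x y : R := \det (row_mx x y : 'M[R]_2).

(* For x != 0, a line that misses the origin. *)
Definition line x : set 'cV[R]_2 := [set y | dot y x = 1]%classic.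

(* Each set is a translate of the other; in particular a line is parallel to
   itself. *)
Definition parallel (L M : set 'cV[R]_2) : Prop :=
  exists t : 'cV[R]_2, M = [set y + t | y in L]%classic.

End Plane.

Section Weavings.
Variables (R : realType) (n : nat) (G : simple_graph n).
Implicit Types (p v : 'I_n -> 'cV[R]_2) (eps omega : 'I_n -> 'I_n -> R).

Definition is_grillage p : Prop :=
  [/\ forall i, p i != 0,
      injective (fun i => line (p i)) &
      forall i j, G i j -> ~ parallel (line (p i)) (line (p j))].

(* The next two are meaningful when the lines i and j are not parallel, that
   is, when the determinant is nonzero. *)
Definition cross_coef p (i j : 'I_n) : R := 1 / det2 (p i) (p j).

Definition crossing p (i j : 'I_n) : 'cV[R]_2 :=
  cross_coef p i j *: rho (p i - p j).

(* Only the values eps i j with i < j and ij an edge are relevant. *)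
Definition is_weaving p eps : Prop :=
  is_grillage p /\
  forall i j, G i j -> (i < j)%N -> eps i j = 1 \/ eps i j = - 1.

Definition is_lifting p eps v : Prop :=
  forall i j, G i j -> (i < j)%N ->
    0 <= eps i j * dot (crossing p i j) (v i - v j).

Definition trivial_lifting p v : Prop :=
  exists (w : 'cV[R]_2) (c : R), forall i, v i = w + c *: p i.

Definition is_flat p eps : Prop :=
  forall v, is_lifting p eps v -> trivial_lifting p v.

Definition is_inf_motion p v : Prop :=
  forall i j, G i j -> dot (p i - p j) (v i - v j) = 0.

Definition trivial_motion p v : Prop :=
  exists (w : 'cV[R]_2) (c : R), forall i, v i = w + c *: rho (p i).

Definition inf_rigid p : Prop :=
  forall v, is_inf_motion p v -> trivial_motion p v.

(* An element of R^E is a function of two vertices, symmetric on edges, whose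
   values off the edges are irrelevant. *)
Definition equilibrium_stress p omega : Prop :=
  (forall i j, G i j -> omega i j = omega j i) /\
  (forall i, \sum_(j | G i j) omega i j *: (p i - p j) = 0).

End Weavings.

(* Main.v *)
Require Import Defs.
From mathcomp Require Import all_boot all_order all_algebra.
From mathcomp Require Import classical_sets reals.
From mathcomp Require Import ring.

Set Implicit Arguments.
Unset Strict Implicit.
Unset Printing Implicit Defensive.

Import Order.TTheory GRing.Theory Num.Theory.
Local Open Scope ring_scope.

(** A lifting [v] of the weaving makes every number
    [omega i j * dot (rho (p i - p j)) (v i - v j)] nonnegative: the sign of the
    crossing coefficient in [eps] cancels the one hidden in the crossing point,
    and only the sign of the stress survives ([lifting_stress_ge0]). On the
    other hand the equilibrium conditions say that these numbers add up to zero
    ([stress_work0]): a stress does no work along any velocity field. So each of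
    them vanishes, and since the stress has no zero,
    [dot (rho (p i - p j)) (v i - v j) = 0] on every edge. Turning the plane
    through a right angle, this says that [- rho (v i)] is an infinitesimal
    motion of the framework; by rigidity it is trivial, and turning back gives a
    trivial lifting.

    The product of signs defining [eps] is never zero, because lines with
    proportional normal vectors are parallel ([det2_neq0]). *)

Section Plane.
Variable R : realType.
Implicit Types x y z : 'cV[R]_2.

Lemma dotE x y : dot x y = x 0 0 * y 0 0 + x 1 0 * y 1 0.
Proof.
rewrite /dot big_ord_recl big_ord1.
by congr (_ + x _ _ * y _ _); apply/val_inj.
Qed.

Lemma cV2P x y : x 0 0 = y 0 0 -> x 1 0 = y 1 0 -> x = y.
Proof.
move=> e0 e1; apply/matrixP => i j; rewrite (ord1 j).
case: i => [[|[|//]] lti].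
- by rewrite (_ : Ordinal lti = 0) //; apply/val_inj.
- by rewrite (_ : Ordinal lti = 1) //; apply/val_inj.
Qed.

Lemma rho0E x : rho x 0 0 = - x 1 0. Proof. by rewrite mxE. Qed.
Lemma rho1E x : rho x 1 0 = x 0 0. Proof. by rewrite mxE. Qed.

Lemma det_mx22 (A : 'M[R]_2) : \det A = A 0 0 * A 1 1 - A 0 1 * A 1 0.
Proof.
have lift00 : lift 0 0 = 1 :> 'I_2 by apply/val_inj.
have lift10 : lift 1 0 = 0 :> 'I_2 by apply/val_inj.
rewrite (expand_det_row _ 0) big_ord_recl big_ord1 /cofactor !det_mx11 !mxE.
by rewrite !lift00 lift10 /= expr0 expr1; ring.
Qed.

Lemma det2E x y : det2 x y = x 0 0 * y 1 0 - x 1 0 * y 0 0.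
Proof.
have e0 : 0 = lshift 1 (0 : 'I_1) by apply/val_inj.
have e1 : 1 = rshift 1 (0 : 'I_1) by apply/val_inj.
have E0 i : row_mx x y i 0 = x i 0 by rewrite [X in row_mx _ _ _ X]e0 row_mxEl.
have E1 i : row_mx x y i 1 = y i 0 by rewrite [X in row_mx _ _ _ X]e1 row_mxEr.
by rewrite /det2 det_mx22 !E0 !E1; ring.
Qed.

Lemma rhoN x : rho (- x) = - rho x.
Proof. by apply: cV2P; rewrite !mxE. Qed.

Lemma rhoD x y : rho (x + y) = rho x + rho y.
Proof. by apply: cV2P; rewrite !mxE //= opprD. Qed.

Lemma rhoZ c x : rho (c *: x) = c *: rho x.
Proof. by apply: cV2P; rewrite !mxE //= mulrN. Qed.

Lemma rho_rho x : rho (rho x) = - x.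
Proof. by apply: cV2P; rewrite !mxE. Qed.

Lemma dot_rho x y : dot (rho x) y = - dot x (rho y).
Proof. by rewrite !dotE !rho0E !rho1E; ring. Qed.

Lemma dotDl x y z : dot (x + y) z = dot x z + dot y z.
Proof. by rewrite !dotE !mxE; ring. Qed.

Lemma dotZl c x y : dot (c *: x) y = c * dot x y.
Proof. by rewrite !dotE !mxE; ring. Qed.

Lemma dotBr x y z : dot x (y - z) = dot x y - dot x z.
Proof. by rewrite !dotE !mxE; ring. Qed.

Lemma dotNN x y : dot (- x) (- y) = dot x y.
Proof. by rewrite !dotE !mxE; ring. Qed.

Lemma dot_self_neq0 x : x != 0 -> dot x x != 0.
Proof.
apply: contraNneq; rewrite dotE -!expr2 => /eqP.
rewrite paddr_eq0 ?sqr_ge0 // !sqrf_eq0 => /andP[/eqP x0 /eqP x1].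
by apply/eqP/cV2P; rewrite mxE.
Qed.

(** If [y = k x], both sides are [k * dot x x * dot z x]. Since the difference of
    the two sides is a multiple of [det2 x y] for all vectors, no such [k] has to
    be produced. *)
Lemma dot_collinear x y z :
  det2 x y = 0 -> dot z y * dot x x = dot z x * dot x y.
Proof.
move=> d0; have : dot z y * dot x x - dot z x * dot x y
    = (z 1 0 * x 0 0 - z 0 0 * x 1 0) * det2 x y.
  by rewrite !dotE det2E; ring.
by rewrite d0 mulr0 => /eqP; rewrite subr_eq0 => /eqP.
Qed.

Lemma det2C x y : det2 x y = - det2 y x.
Proof. by rewrite !det2E; ring. Qed.

(** For [x != 0], the point of [line x] closest to the origin. *)
Definition foot x := (dot x x)^-1 *: x.

(** Both lines are perpendicular to the same direction, so the translation that
    takes one foot to the other takes one line into the other. *)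
Lemma line_translate x y z : x != 0 -> y != 0 -> det2 x y = 0 ->
  line x z -> line y (z + (foot y - foot x)).
Proof.
move=> x0 y0 d0 zx.
have nx := dot_self_neq0 x0; have ny := dot_self_neq0 y0.
have zy : dot z y = (dot x x)^-1 * dot x y.
  apply: (mulIf nx); rewrite (dot_collinear _ d0) zx mul1r.
  by rewrite mulrAC mulVf ?mul1r.
rewrite /line /foot /= -scaleNr !dotDl !dotZl mulVf // zy; ring.
Qed.

Lemma det2_neq0 x y :
  x != 0 -> y != 0 -> ~ parallel (line x) (line y) -> det2 x y != 0.
Proof.
move=> x0 y0 npar; apply/eqP => d0; apply: npar.
exists (foot y - foot x); apply/seteqP; split => [z zy|_ [z zx <-]]; last first.
  exact: line_translate.
exists (z + (foot x - foot y)); last by rewrite -(opprB (foot x)) addrK.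
by apply: line_translate => //; rewrite det2C d0 oppr0.
Qed.

End Plane.

Section Weavings.
Variables (R : realType) (n : nat) (G : simple_graph n).
Implicit Types (p v : 'I_n -> 'cV[R]_2) (eps omega : 'I_n -> 'I_n -> R).

Lemma cross_coef_neq0 p i j :
  is_grillage G p -> G i j -> cross_coef p i j != 0.
Proof.
case=> p0 _ npar Gij.
by rewrite /cross_coef mul1r invr_eq0 det2_neq0 //; exact: npar.
Qed.

Lemma dot_rho_sym p v i j :
  dot (rho (p j - p i)) (v j - v i) = dot (rho (p i - p j)) (v i - v j).
Proof. by rewrite -(opprB (p i)) -(opprB (v i)) rhoN dotNN. Qed.

(** Both orientations of an edge contribute equally, so the double sum is twice
    the sum over [i] of the pairing of [v i] with the rotated resultant of the
    stress at [i], and every resultant vanishes. *)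
Lemma stress_work0 p omega v : equilibrium_stress G p omega ->
  \sum_i \sum_(j | G i j) omega i j * dot (rho (p i - p j)) (v i - v j) = 0.
Proof.
case=> osym equil.
pose half := \sum_i \sum_(j | G i j) omega i j * dot (rho (p i - p j)) (v i).
have half0 : half = 0.
  have rho0 (u : 'cV[R]_2) : dot (rho 0) u = 0.
    by rewrite dotE rho0E rho1E !mxE; ring.
  apply: big1 => i _; rewrite -[RHS](rho0 (v i)) -(equil i).
  have addf : {morph (fun x => dot (rho x) (v i)) : x y / x + y}.
    by move=> x y; rewrite rhoD dotDl.
  rewrite (big_morph (fun x => dot (rho x) (v i)) addf (rho0 _)).
  by apply: eq_bigr => j _; rewrite rhoZ dotZl.
have swap : \sum_i \sum_(j | G i j) omega i j * dot (rho (p i - p j)) (v j)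
    = - half.
  rewrite /half -sumrN; under [RHS]eq_bigr do rewrite -sumrN.
  rewrite [LHS](exchange_big_dep xpredT) //=; apply: eq_bigr => i _.
  under eq_bigl do rewrite edge_sym.
  apply: eq_bigr => j Gij.
  by rewrite (osym i j Gij) -(opprB (p i)) rhoN -scaleN1r dotZl; ring.
under eq_bigr do under eq_bigr do rewrite dotBr mulrBr.
under eq_bigr do rewrite sumrB.
by rewrite sumrB swap -/half half0 oppr0 subr0.
Qed.

(** The lifting condition is only imposed for [i < j], but exchanging [i] and [j]
    changes neither the stress nor the pairing. For [i < j] the condition is
    [0 <= Num.sg omega * (|s| * a)], with [s] the crossing coefficient and [a] the
    pairing, and [|s|] is positive. *)
Lemma lifting_stress_ge0 p omega eps v :
  is_grillage G p ->
  (forall i j, G i j -> omega i j = omega j i) ->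
  (forall i j, G i j -> (i < j)%N ->
     eps i j = Num.sg (omega i j) * Num.sg (cross_coef p i j)) ->
  is_lifting G p eps v ->
  forall i j, G i j -> 0 <= omega i j * dot (rho (p i - p j)) (v i - v j).
Proof.
move=> grill osym epsE lift.
have ordered i j : G i j -> (i < j)%N ->
    0 <= omega i j * dot (rho (p i - p j)) (v i - v j).
  move=> Gij ltij; have := lift i j Gij ltij.
  rewrite epsE // /crossing dotZl mulrACA -mulrA.
  set s := cross_coef p i j; set a := dot _ _; set o := omega i j => ge0.
  have s_gt0 : 0 < `|s| by rewrite normr_gt0 cross_coef_neq0.
  have -> : o * a = `|o| / `|s| * (Num.sg o * (s * (Num.sg s * a))).
    rewrite [in LHS](numEsg o) -[LHS](mulfK (lt0r_neq0 s_gt0)).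
    by rewrite [in X in X / _](normrEsg s); ring.
  by rewrite mulr_ge0 // divr_ge0.
move=> i j Gij; case: (ltngtP i j) => [ltij|ltji|/val_inj eij].
- exact: ordered.
- by rewrite osym // -dot_rho_sym ordered // edge_sym.
- by move: Gij; rewrite eij edge_irrefl.
Qed.

Lemma rigid_trivial_lifting p v : inf_rigid G p ->
  (forall i j, G i j -> dot (rho (p i - p j)) (v i - v j) = 0) ->
  trivial_lifting p v.
Proof.
move=> rigid perp.
have [|w [c vE]] := rigid (fun i => - rho (v i)).
  move=> i j Gij; rewrite -(perp i j Gij) dot_rho rhoD rhoN.
  by rewrite !dotE !mxE; ring.
exists (rho w), (- c) => i.
have := congr1 (@rho R) (vE i).
by rewrite rhoN rho_rho opprK rhoD rhoZ rho_rho scalerN scaleNr.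
Qed.

End Weavings.

Theorem mainTheorem3 (R : realType) (n : nat) (G : simple_graph n)
    (p : 'I_n -> 'cV[R]_2) (omega eps : 'I_n -> 'I_n -> R)
    (grillage_p : is_grillage G p)
    (rigid_p : inf_rigid G p)
    (stress_omega : equilibrium_stress G p omega)
    (omega_neq0 : forall i j : 'I_n, G i j -> omega i j != 0)
    (epsE : forall i j : 'I_n, G i j -> (i < j)%N ->
       eps i j = Num.sg (omega i j) * Num.sg (cross_coef p i j)) :
  is_weaving G p eps /\ is_flat G p eps.
Proof.
have [osym _] := stress_omega; split; first split=> // i j Gij ltij.
  have sg_unit (x : R) : x != 0 -> Num.sg x = 1 \/ Num.sg x = - 1.
    by case: sgrP => // _ _; [left|right].
  rewrite epsE //.
  have [->|->] := sg_unit _ (omega_neq0 _ _ Gij);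
    have [->|->] := sg_unit _ (cross_coef_neq0 grillage_p Gij);
    rewrite ?mulrNN ?mul1r ?mulr1; by [left|right].
move=> v lift; apply: rigid_trivial_lifting rigid_p _ => i j Gij.
have ge0 := lifting_stress_ge0 grillage_p osym epsE lift.
have row_ge0 k : 0 <= \sum_(l | G k l)
    omega k l * dot (rho (p k - p l)) (v k - v l).
  by apply: sumr_ge0 => l; exact: ge0.
have row0 := psumr_eq0P (fun k _ => row_ge0 k) (stress_work0 v stress_omega).
have /eqP := psumr_eq0P (ge0 i) (row0 i isT) Gij.
by rewrite mulf_eq0 (negPf (omega_neq0 _ _ Gij)) => /eqP.
Qed.
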